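(* Let $\eta_0$ be a spanning tree of $\eta$, let $\varepsilon_1$ be the set of edges of $\eta$ that are not in $\eta_0$, let $\omega\in\Omega$ be a voltage on $\eta$, and let $\chi=(\eta,\kappa,\omega)$. Then there is a representation $\omega=[\xi,\alpha]$ and an induced isomorphism of vector spaces $$\ker L_\chi\;\cong\;\begin{cases}\mathbb{R}^d & \text{if }\varepsilon_1=\emptyset,\\[1mm] \bigcap_{i>j\in\varepsilon_1}E_1(\alpha_{ij}) & \text{otherwise,}\end{cases}$$ where $E_1(\cdot)\subset\mathbb{R}^d$ denotes the eigenspace of a matrix for the eigenvalue $1$.
   Context: **Graph and data.** $\eta$ is a finite, connected, simple, directed graph with vertex set $\nu=\{1,\dots,N\}$, $N\ge2$. The directed edge relation is written $i<j$ (equivalently $j>i$), at most one of $i<j$, $j<i$ holds, and $i\sim j$ means $i<j$ or $j<i$. $\kappa:\nu\times\nu\to\mathbb{R}_{\ge0}$ is symmetric, $\kappa_{ij}>0$ if $i\sim j$ and $\kappa_{ij}=0$ otherwise; $Z_i=\sum_{j}\kappa_{ij}$. Fix an integer $d>0$; $X=(\mathbb{R}^d)^N$; $\Xi=\mathrm{SO}(d)^N$ acts on $X$ by $(\xi x)_i=\xi_ix_i$. **Sections.** $\Gamma=(\Xi\times X)/\Xi$ is the set of classes $[\xi,x]$ with identifications $[\xi\tau,x]=[\xi,\tau x]$, $\tau\in\Xi$; it is a vector space via $[\xi,x]+[\xi,x']=[\xi,x+x']$, $r[\xi,x]=[\xi,rx]$. **Voltages.** $\mathcal{A}$ is the set of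 functions $\alpha:\nu\times\nu\to\mathrm{SO}(d)$ with $\alpha_{ij}=\mathbf{I}$ if $i\not\sim j$ and $\alpha_{ij}=\alpha_{ji}^{-1}$ otherwise. $\Xi$ acts by $(\xi\alpha)_{ij}=\xi_i\alpha_{ij}\xi_j^{-1}$. $\Omega=(\Xi\times\mathcal{A})/\Xi$ is the set of classes $[\xi,\alpha]$ with $[\xi\tau,\alpha]=[\xi,\tau\alpha]$. A representation of $\omega$ is a pair $(\xi,\alpha)$ with $\omega=[\xi,\alpha]$. **Gauged Laplacian.** For $\chi=(\eta,\kappa,\omega)$, $\omega=[\xi,\alpha]$: $L_\chi:\Gamma\to\Gamma$, $L_\chi([\xi,x])=[\xi,\Delta_{\eta,\kappa,\alpha}x]$, $(\Delta_{\eta,\kappa,\alpha}x)_i=-\sum_{j\in\nu}\frac{\kappa_{ij}}{Z_i}(\alpha_{ij}x_j-x_i)$ (same $\xi$ for section and voltage; well defined).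
   Formalization: The action (ξα)_ij = ξ_i α_ij ξ_j^{-1} is applied only to adjacent i, j; for non-adjacent pairs the value stays I, since the formula as printed would not preserve the set of voltages. *)

(* Defs.v *)
From HB Require Import structures.
From mathcomp Require Import all_boot all_order all_algebra.
From mathcomp Require Import boolp reals.

Set Implicit Arguments.
Unset Strict Implicit.
Unset Printing Implicit Defensive.

Import Order.TTheory GRing.Theory Num.Theory.
Local Open Scope ring_scope.
Local Open Scope quotient_scope.

Record gaction (G : groupType) (Y : Type) := GAction {
  act :> G -> Y -> Y;
  act1 : forall y, act 1%g y = y;
  actM : forall s t y, act (s * t)%g y = act s (act t y)
}.

(* Identifies (s * t, y) with (s, t y); the quotient is (G x Y) / G. *)
Definition balanced_rel (G : groupType) (Y : Type) (to : gaction G Y) :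
    rel (G * Y) :=
  fun p q => `[< exists t : G, p.1 = (q.1 * t)%g /\ q.2 = to t p.2 >].

Lemma balanced_refl (G : groupType) (Y : Type) (to : gaction G Y) :
  reflexive (balanced_rel to).
Proof. by move=> p; apply/asboolP; exists 1%g; rewrite mulg1 act1. Qed.

Lemma balanced_sym (G : groupType) (Y : Type) (to : gaction G Y) :
  symmetric (balanced_rel to).
Proof.
have H p q : balanced_rel to p q -> balanced_rel to q p.
  move=> /asboolP[t [e1 e2]]; apply/asboolP; exists (t^-1)%g.
  by rewrite e1 mulgK e2 -actM mulVg act1.
by move=> p q; apply/idP/idP; apply: H.
Qed.

Lemma balanced_trans (G : groupType) (Y : Type) (to : gaction G Y) :
  transitive (balanced_rel to).
Proof.
move=> q p r /asboolP[t [e1 e2]] /asboolP[s [e3 e4]]; apply/asboolP.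
by exists (s * t)%g; rewrite e1 e3 e4 e2 mulgA actM.
Qed.

Canonical balanced_equiv (G : groupType) (Y : Type) (to : gaction G Y) :=
  EquivRel (balanced_rel to)
    (balanced_refl to) (balanced_sym to) (@balanced_trans G Y to).

Definition balanced (G : groupType) (Y : choiceType) (to : gaction G Y) :=
  {eq_quot balanced_rel to}.

HB.instance Definition _ (G : groupType) (Y : choiceType) (to : gaction G Y) :=
  Choice.on (balanced to).
HB.instance Definition _ (G : groupType) (Y : choiceType) (to : gaction G Y) :=
  EqQuotient.on (balanced to).

(* The class [s, y]. *)
Definition class (G : groupType) (Y : choiceType) (to : gaction G Y)
  (s : G) (y : Y) : balanced to := \pi_(balanced to) (s, y).

(* For each s, every class c can be written [s, y] for a unique y; this is
   coord s c. *)
Definition coord (G : groupType) (Y : choiceType) (to : gaction G Y)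
  (s : G) (c : balanced to) : Y := to (s^-1 * (repr c).1)%g (repr c).2.

Lemma class_eqP (G : groupType) (Y : choiceType) (to : gaction G Y)
    (s s' : G) (y y' : Y) :
  class to s y = class to s' y' <->
  exists t : G, s = (s' * t)%g /\ y' = to t y.
Proof.
split; first by move=> /eqmodP/asboolP.
by move=> h; apply/eqmodP/asboolP.
Qed.

Lemma class_act (G : groupType) (Y : choiceType) (to : gaction G Y)
    (s t : G) (y : Y) :
  class to (s * t)%g y = class to s (to t y).
Proof. by apply/class_eqP; exists t. Qed.

Lemma coordK (G : groupType) (Y : choiceType) (to : gaction G Y) (s : G) :
  cancel (@coord G Y to s) (class to s).
Proof.
by move=> c; rewrite /coord -class_act mulVKg /class -surjective_pairing reprK.
Qed.

Lemma class_inj (G : groupType) (Y : choiceType) (to : gaction G Y) (s : G) :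
  injective (class to s).
Proof.
move=> y y' /class_eqP[t [e ->]].
by rewrite (_ : t = 1%g) ?act1 //; apply: (@mulgI _ s); rewrite -e mulg1.
Qed.

Lemma classK (G : groupType) (Y : choiceType) (to : gaction G Y) (s : G) :
  cancel (class to s) (@coord G Y to s).
Proof. by move=> y; apply: (@class_inj _ _ to s); rewrite coordK. Qed.

Definition is_SO (R : realType) (d : nat) (A : 'M[R]_d) : bool :=
  (A *m A^T == 1%:M) && (\det A == 1).

Record SO (R : realType) (d : nat) :=
  MkSO { SOval :> 'M[R]_d; SOvalP : is_SO SOval }.

HB.instance Definition _ (R : realType) (d : nat) := [isSub for @SOval R d].
HB.instance Definition _ (R : realType) (d : nat) :=
  [Choice of SO R d by <:].

Lemma SO_mulmxT (R : realType) (d : nat) (A : SO R d) : A *m A^T = 1%:M.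
Proof. by case: A => A /= /andP[/eqP]. Qed.

Lemma SO_mulTmx (R : realType) (d : nat) (A : SO R d) : A^T *m A = 1%:M.
Proof. exact: mulmx1C (SO_mulmxT A). Qed.

Lemma SO_det (R : realType) (d : nat) (A : SO R d) : \det A = 1.
Proof. by case: A => A /= /andP[_ /eqP]. Qed.

Fact SO1_subproof (R : realType) (d : nat) : is_SO (1%:M : 'M[R]_d).
Proof. by rewrite /is_SO trmx1 mulmx1 det1 !eqxx. Qed.

Fact SOM_subproof (R : realType) (d : nat) (A B : SO R d) : is_SO (A *m B).
Proof.
rewrite /is_SO trmx_mul mulmxA -(mulmxA A) SO_mulmxT mulmx1 SO_mulmxT.
by rewrite det_mulmx !SO_det mulr1 !eqxx.
Qed.

Fact SOV_subproof (R : realType) (d : nat) (A : SO R d) : is_SO (A^T).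
Proof. by rewrite /is_SO trmxK SO_mulTmx det_tr SO_det !eqxx. Qed.

Definition SO1 (R : realType) (d : nat) : SO R d := MkSO (SO1_subproof R d).
Definition SOM (R : realType) (d : nat) (A B : SO R d) : SO R d :=
  MkSO (SOM_subproof A B).
Definition SOV (R : realType) (d : nat) (A : SO R d) : SO R d :=
  MkSO (SOV_subproof A).

Fact SO_mulA (R : realType) (d : nat) : associative (@SOM R d).
Proof. by move=> A B C; apply: val_inj; rewrite /= mulmxA. Qed.
Fact SO_mul1 (R : realType) (d : nat) : left_id (SO1 R d) (@SOM R d).
Proof. by move=> A; apply: val_inj; rewrite /= mul1mx. Qed.
Fact SO_mulr1 (R : realType) (d : nat) : right_id (SO1 R d) (@SOM R d).
Proof. by move=> A; apply: val_inj; rewrite /= mulmx1. Qed.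
Fact SO_mulV (R : realType) (d : nat) :
  left_inverse (SO1 R d) (@SOV R d) (@SOM R d).
Proof. by move=> A; apply: val_inj; rewrite /= SO_mulTmx. Qed.
Fact SO_mulrV (R : realType) (d : nat) :
  right_inverse (SO1 R d) (@SOV R d) (@SOM R d).
Proof. by move=> A; apply: val_inj; rewrite /= SO_mulmxT. Qed.

HB.instance Definition _ (R : realType) (d : nat) :=
  isGroup.Build (SO R d) (@SO_mulA R d) (@SO_mul1 R d) (@SO_mulr1 R d)
    (@SO_mulV R d) (@SO_mulrV R d).

(* edge i j means i < j; asymmetry also excludes loops. *)
Record digraph (N : nat) := Digraph {
  edge : rel 'I_N;
  edge_asym : forall i j, edge i j -> ~~ edge j i;
  edge_connected :
    forall i j, connect (fun k l => edge k l || edge l k) i j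
}.

Definition adj (N : nat) (eta : digraph N) : rel 'I_N :=
  fun i j => edge eta i j || edge eta j i.

Lemma adjC (N : nat) (eta : digraph N) i j : adj eta i j = adj eta j i.
Proof. by rewrite /adj orbC. Qed.

Definition acyclic (N : nat) (eta : digraph N) :=
  forall c : seq 'I_N, (2 < size c)%N -> ~ ucycle (adj eta) c.

(* Connectedness of the tree is part of digraph N, and it has the same vertex
   set as eta. *)
Definition spanning_tree (N : nat) (eta0 eta : digraph N) :=
  subrel (edge eta0) (edge eta) /\ acyclic eta0.

(* The pair (i, j) stands for the edge i < j. *)
Definition non_tree_edges (N : nat) (eta0 eta : digraph N) :
    {set 'I_N * 'I_N} :=
  [set p | edge eta p.1 p.2 && ~~ edge eta0 p.1 p.2].

Record weight (R : realType) (N : nat) (eta : digraph N) := Weight {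
  kappa :> 'I_N -> 'I_N -> R;
  kappa_sym : forall i j, kappa i j = kappa j i;
  kappa_gt0 : forall i j, adj eta i j -> 0 < kappa i j;
  kappa_eq0 : forall i j, ~~ adj eta i j -> kappa i j = 0
}.

Definition gauge (R : realType) (N d : nat) := {ffun 'I_N -> SO R d}.
HB.instance Definition _ (R : realType) (N d : nat) := Group.on (gauge R N d).

Lemma gauge1E (R : realType) (N d : nat) (i : 'I_N) :
  (1%g : gauge R N d) i = 1%g.
Proof. exact: ffunE. Qed.

Lemma gaugeME (R : realType) (N d : nat) (s t : gauge R N d) (i : 'I_N) :
  (s * t)%g i = (s i * t i)%g.
Proof. exact: ffunE. Qed.

Lemma gaugeVE (R : realType) (N d : nat) (s : gauge R N d) (i : 'I_N) :
  (s^-1)%g i = ((s i)^-1)%g.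
Proof. exact: ffunE. Qed.

Definition config (R : realType) (N d : nat) := {ffun 'I_N -> 'cV[R]_d}.
HB.instance Definition _ (R : realType) (N d : nat) :=
  Vector.on (config R N d).

Definition gauge_config (R : realType) (N d : nat)
    (xi : gauge R N d) (x : config R N d) : config R N d :=
  [ffun i => (xi i : 'M[R]_d) *m x i].

Fact gauge_config1 (R : realType) (N d : nat) (x : config R N d) :
  gauge_config 1%g x = x.
Proof. by apply/ffunP=> i; rewrite !ffunE /= mul1mx. Qed.

Fact gauge_configM (R : realType) (N d : nat) (s t : gauge R N d)
    (x : config R N d) :
  gauge_config (s * t)%g x = gauge_config s (gauge_config t x).
Proof. by apply/ffunP=> i; rewrite !ffunE /= mulmxA. Qed.

Definition config_action (R : realType) (N d : nat) :
    gaction (gauge R N d) (config R N d) :=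
  GAction (@gauge_config1 R N d) (@gauge_configM R N d).

Fact gauge_config_linear (R : realType) (N d : nat) (xi : gauge R N d) :
  linear (gauge_config xi).
Proof.
by move=> a x y; apply/ffunP=> i; rewrite !ffunE mulmxDr -scalemxAr.
Qed.

Definition gsection (R : realType) (N d : nat) :=
  balanced (config_action R N d).
HB.instance Definition _ (R : realType) (N d : nat) :=
  Choice.on (gsection R N d).

Definition sect (R : realType) (N d : nat) (xi : gauge R N d)
    (x : config R N d) : gsection R N d := class (config_action R N d) xi x.

Definition sect_coord (R : realType) (N d : nat) (xi : gauge R N d)
    (g : gsection R N d) : config R N d := coord xi g.

Lemma sect_coordK (R : realType) (N d : nat) (xi : gauge R N d) :
  cancel (@sect_coord R N d xi) (sect xi).
Proof. exact: coordK. Qed.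

Lemma sectK (R : realType) (N d : nat) (xi : gauge R N d) :
  cancel (sect xi) (@sect_coord R N d xi).
Proof. exact: classK. Qed.

Lemma sect_act (R : realType) (N d : nat) (xi tau : gauge R N d)
    (x : config R N d) :
  sect (xi * tau)%g x = sect xi (gauge_config tau x).
Proof. exact: class_act. Qed.

(* The operations are computed on the representatives [1, x]; sectD and sectZ
   show that any common first component gives the same result. *)
Definition gs_zero (R : realType) (N d : nat) : gsection R N d := sect 1%g 0.
Definition gs_opp (R : realType) (N d : nat) (g : gsection R N d) :=
  sect 1%g (- sect_coord 1%g g).
Definition gs_add (R : realType) (N d : nat) (g h : gsection R N d) :=
  sect 1%g (sect_coord 1%g g + sect_coord 1%g h).
Definition gs_scale (R : realType) (N d : nat) (r : R)
  (g : gsection R N d) := sect 1%g (r *: sect_coord 1%g g).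

Fact gs_addA (R : realType) (N d : nat) : associative (@gs_add R N d).
Proof. by move=> f g h; rewrite /gs_add !sectK addrA. Qed.
Fact gs_addC (R : realType) (N d : nat) : commutative (@gs_add R N d).
Proof. by move=> f g; rewrite /gs_add addrC. Qed.
Fact gs_add0 (R : realType) (N d : nat) :
  left_id (@gs_zero R N d) (@gs_add R N d).
Proof. by move=> f; rewrite /gs_add /gs_zero sectK add0r sect_coordK. Qed.
Fact gs_addN (R : realType) (N d : nat) :
  left_inverse (@gs_zero R N d) (@gs_opp R N d) (@gs_add R N d).
Proof. by move=> f; rewrite /gs_add /gs_opp sectK addNr. Qed.

HB.instance Definition _ (R : realType) (N d : nat) :=
  GRing.isZmodule.Build (gsection R N d) (@gs_addA R N d) (@gs_addC R N d)
    (@gs_add0 R N d) (@gs_addN R N d).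

Fact gs_scaleA (R : realType) (N d : nat) (a b : R) (g : gsection R N d) :
  gs_scale a (gs_scale b g) = gs_scale (a * b) g.
Proof. by rewrite /gs_scale sectK scalerA. Qed.
Fact gs_scale1 (R : realType) (N d : nat) : left_id 1 (@gs_scale R N d).
Proof. by move=> g; rewrite /gs_scale scale1r sect_coordK. Qed.
Fact gs_scaleDr (R : realType) (N d : nat) :
  right_distributive (@gs_scale R N d) +%R.
Proof.
by move=> a g h; rewrite /gs_scale -[_ + _ in RHS]/(gs_add _ _) /gs_add !sectK
  -scalerDr.
Qed.
Fact gs_scaleDl (R : realType) (N d : nat) (g : gsection R N d) :
  {morph (@gs_scale R N d)^~ g : a b / a + b}.
Proof.
by move=> a b; rewrite /gs_scale -[_ + _ in RHS]/(gs_add _ _) /gs_add !sectK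
  -scalerDl.
Qed.

HB.instance Definition _ (R : realType) (N d : nat) :=
  GRing.Zmodule_isLmodule.Build R (gsection R N d)
    (@gs_scaleA R N d) (@gs_scale1 R N d) (@gs_scaleDr R N d)
    (@gs_scaleDl R N d).

Lemma sect_is_linear (R : realType) (N d : nat) (xi : gauge R N d) :
  linear (sect xi).
Proof.
move=> r x y.
have e z : sect xi z = sect 1%g (gauge_config xi z) by rewrite -sect_act mul1g.
rewrite !e gauge_config_linear.
rewrite -[_ + _ in RHS]/(gs_add _ _) -[_ *: _ in RHS]/(gs_scale _ _).
by rewrite /gs_add /gs_scale !sectK.
Qed.

HB.instance Definition _ (R : realType) (N d : nat) (xi : gauge R N d) :=
  GRing.isLinear.Build R (config R N d) (gsection R N d) _ (sect xi)
    (@sect_is_linear R N d xi).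

Lemma sectD (R : realType) (N d : nat) (xi : gauge R N d)
    (x y : config R N d) :
  sect xi x + sect xi y = sect xi (x + y).
Proof. by rewrite linearD. Qed.

Lemma sectZ (R : realType) (N d : nat) (xi : gauge R N d) (r : R)
    (x : config R N d) :
  r *: sect xi x = sect xi (r *: x).
Proof. by rewrite linearZ. Qed.

Lemma sect_coord_is_linear (R : realType) (N d : nat) (xi : gauge R N d) :
  linear (@sect_coord R N d xi).
Proof.
move=> r g h; apply: (can_inj (sectK xi)).
by rewrite linearP /= !sect_coordK.
Qed.

HB.instance Definition _ (R : realType) (N d : nat) (xi : gauge R N d) :=
  GRing.isLinear.Build R (gsection R N d) (config R N d) _ (@sect_coord R N d xi)
    (@sect_coord_is_linear R N d xi).

Fact gsection_vect_iso (R : realType) (N d : nat) :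
  Vector.axiom (dim (config R N d)) (gsection R N d).
Proof.
exists (fun g => VectorInternalTheory.v2r (sect_coord 1%g g)).
  move=> r g h; rewrite sect_coord_is_linear.
  have [vZ vD] := v2r_semilinear
    (VectorInternalTheory.v2r_subproof (config R N d)).
  by rewrite -vZ -vD.
exists (fun v => sect 1%g (VectorInternalTheory.r2v v)).
  by move=> g; rewrite VectorInternalTheory.v2rK sect_coordK.
by move=> v; rewrite sectK VectorInternalTheory.r2vK.
Qed.

HB.instance Definition _ (R : realType) (N d : nat) :=
  Lmodule_hasFinDim.Build R (gsection R N d) (@gsection_vect_iso R N d).

Definition is_voltage (R : realType) (N d : nat) (eta : digraph N)
    (a : {ffun 'I_N * 'I_N -> SO R d}) : bool :=
  [forall i, forall j,
     if adj eta i j then a (i, j) == (a (j, i))^-1%g else a (i, j) == 1%g].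

Record voltage (R : realType) (N d : nat) (eta : digraph N) := Voltage {
  voltage_val : {ffun 'I_N * 'I_N -> SO R d};
  voltageP : is_voltage eta voltage_val
}.
Arguments voltage R {N} d eta.

HB.instance Definition _ (R : realType) (N d : nat) (eta : digraph N) :=
  [isSub for @voltage_val R N d eta].
HB.instance Definition _ (R : realType) (N d : nat) (eta : digraph N) :=
  [Choice of voltage R d eta by <:].

Definition volt (R : realType) (N d : nat) (eta : digraph N)
  (a : voltage R d eta) (i j : 'I_N) : SO R d := voltage_val a (i, j).
Coercion volt : voltage >-> Funclass.

Lemma volt_adj (R : realType) (N d : nat) (eta : digraph N)
    (a : voltage R d eta) i j : adj eta i j -> a i j = (a j i)^-1%g.
Proof.
by case: a => a H; move/forallP/(_ i)/forallP/(_ j): (H) => + h; rewrite h => /eqP.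
Qed.

Lemma volt_nadj (R : realType) (N d : nat) (eta : digraph N)
    (a : voltage R d eta) i j : ~~ adj eta i j -> a i j = 1%g.
Proof.
by case: a => a H; move/forallP/(_ i)/forallP/(_ j): (H) => + /negPf h;
  rewrite h => /eqP.
Qed.

(* The value at a non-adjacent pair stays the identity, so that the result is
   again a voltage; the formula xi_i a_ij xi_j^-1 is used on adjacent pairs. *)
Definition gauge_voltage_val (R : realType) (N d : nat) (eta : digraph N)
    (xi : gauge R N d) (a : voltage R d eta) : {ffun 'I_N * 'I_N -> SO R d} :=
  [ffun p => if adj eta p.1 p.2
             then (xi p.1 * a p.1 p.2 * (xi p.2)^-1)%g else 1%g].

Fact gauge_voltage_subproof (R : realType) (N d : nat) (eta : digraph N)
    (xi : gauge R N d) (a : voltage R d eta) :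
  is_voltage eta (gauge_voltage_val xi a).
Proof.
apply/forallP=> i; apply/forallP=> j; rewrite !ffunE /= (adjC _ j i).
have [h|h] := boolP (adj eta i j); last by rewrite eqxx.
by rewrite (volt_adj a h) !invgM invgK mulgA.
Qed.

Definition gauge_voltage (R : realType) (N d : nat) (eta : digraph N)
    (xi : gauge R N d) (a : voltage R d eta) : voltage R d eta :=
  Voltage (gauge_voltage_subproof xi a).

Lemma gauge_voltageE (R : realType) (N d : nat) (eta : digraph N)
    (xi : gauge R N d) (a : voltage R d eta) i j :
  adj eta i j -> gauge_voltage xi a i j = (xi i * a i j * (xi j)^-1)%g.
Proof. by move=> h; rewrite /volt /= ffunE /= h. Qed.

Fact gauge_voltage1 (R : realType) (N d : nat) (eta : digraph N)
    (a : voltage R d eta) : gauge_voltage 1%g a = a.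
Proof.
apply: val_inj; apply/ffunP=> -[i j]; rewrite /= ffunE /=.
case: ifP => [_|/negbT h]; first by rewrite !gauge1E invg1 mulg1 mul1g.
by rewrite -[RHS]/(a i j) volt_nadj.
Qed.

Fact gauge_voltageM (R : realType) (N d : nat) (eta : digraph N)
    (s t : gauge R N d) (a : voltage R d eta) :
  gauge_voltage (s * t)%g a = gauge_voltage s (gauge_voltage t a).
Proof.
apply: val_inj; apply/ffunP=> -[i j]; rewrite /= ffunE [RHS]ffunE /=.
case: ifP => // h; rewrite gauge_voltageE // !gaugeME invgM.
by rewrite !mulgA.
Qed.

Definition voltage_action (R : realType) (N d : nat) (eta : digraph N) :
    gaction (gauge R N d) (voltage R d eta) :=
  GAction (@gauge_voltage1 R N d eta) (@gauge_voltageM R N d eta).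
Arguments voltage_action R {N} d eta.

Definition voltage_class (R : realType) (N d : nat) (eta : digraph N) :=
  balanced (voltage_action R d eta).
Arguments voltage_class R {N} d eta.

Definition vclass (R : realType) (N d : nat) (eta : digraph N)
    (xi : gauge R N d) (a : voltage R d eta) : voltage_class R d eta :=
  class (voltage_action R d eta) xi a.

Definition degree (R : realType) (N : nat) (eta : digraph N)
  (k : weight R eta) (i : 'I_N) : R := \sum_j k i j.

Definition laplacian (R : realType) (N d : nat) (eta : digraph N)
    (k : weight R eta) (a : voltage R d eta) (x : config R N d) :
    config R N d :=
  [ffun i => - \sum_j (k i j / degree k i) *:
                 ((a i j : 'M[R]_d) *m x j - x i)].

Lemma laplacian_is_linear (R : realType) (N d : nat) (eta : digraph N)
    (k : weight R eta) (a : voltage R d eta) :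
  linear (laplacian k a).
Proof.
move=> r x y; apply/ffunP=> i; rewrite !ffunE scalerN -opprD; congr (- _).
rewrite scaler_sumr -big_split /=; apply: eq_bigr => j _.
move: (k i j / _) => c; rewrite !ffunE mulmxDr -scalemxAr scalerA (mulrC r).
by rewrite -scalerA -scalerDr; congr (_ *: _); rewrite scalerBr addrACA opprD.
Qed.

Lemma laplacian_gauge (R : realType) (N d : nat) (eta : digraph N)
    (k : weight R eta) (tau : gauge R N d) (a : voltage R d eta)
    (x : config R N d) :
  laplacian k (gauge_voltage tau a) (gauge_config tau x)
    = gauge_config tau (laplacian k a x).
Proof.
apply/ffunP=> i; rewrite !ffunE mulmxN mulmx_sumr; congr (- _).
apply: eq_bigr => j _; rewrite -scalemxAr.
have [h|h] := boolP (adj eta i j); last by rewrite kappa_eq0 // mul0r !scale0r.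
rewrite gauge_voltageE // !ffunE mulmxBr /= !mulmxA.
by rewrite -(mulmxA (_ *m _) _ (SOval (tau j))) SO_mulTmx mulmx1.
Qed.

(* Computed with the representative (xi, a) of w selected by repr; gLapE shows
   that every representation gives the same map. *)
Definition gLap (R : realType) (N d : nat) (eta : digraph N)
    (k : weight R eta) (w : voltage_class R d eta) (g : gsection R N d) :
    gsection R N d :=
  sect (repr w).1 (laplacian k (repr w).2 (sect_coord (repr w).1 g)).

Lemma gLap_is_linear (R : realType) (N d : nat) (eta : digraph N)
    (k : weight R eta) (w : voltage_class R d eta) :
  linear (gLap k w).
Proof. by move=> r g h; rewrite /gLap linearP laplacian_is_linear linearP. Qed.

HB.instance Definition _ (R : realType) (N d : nat) (eta : digraph N)
    (k : weight R eta) (w : voltage_class R d eta) :=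
  GRing.isLinear.Build R (gsection R N d) (gsection R N d) _ (gLap k w)
    (gLap_is_linear k w).

Lemma gLapE (R : realType) (N d : nat) (eta : digraph N)
    (k : weight R eta) (xi : gauge R N d) (a : voltage R d eta)
    (x : config R N d) :
  gLap k (vclass xi a) (sect xi x) = sect xi (laplacian k a x).
Proof.
rewrite /gLap; set w := vclass xi a.
have : vclass (repr w).1 (repr w).2 = vclass xi a.
  by rewrite /vclass /class -surjective_pairing reprK.
move=> /class_eqP[t [-> ->]].
have -> : sect xi x = sect (xi * t)%g (gauge_config t^-1%g x).
  by rewrite sect_act -gauge_configM mulgV gauge_config1.
rewrite sectK sect_act -laplacian_gauge -gauge_configM mulgV gauge_config1.
by [].
Qed.

Definition ker_gLap (R : realType) (N d : nat) (eta : digraph N)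
    (k : weight R eta) (w : voltage_class R d eta) :
    {vspace gsection R N d} :=
  lker (linfun (gLap k w)).

Lemma mem_ker_gLap (R : realType) (N d : nat) (eta : digraph N)
    (k : weight R eta) (w : voltage_class R d eta) (g : gsection R N d) :
  (g \in ker_gLap k w) = (gLap k w g == 0).
Proof. by rewrite memv_ker lfunE. Qed.

(* A acts on column vectors, unlike in mxalgebra's eigenspace. *)
Definition E1 (R : realType) (d : nat) (A : 'M[R]_d) : {vspace 'cV[R]_d} :=
  passmx.leigenspace (linfun (mulmx A)) 1.

Lemma mem_E1 (R : realType) (d : nat) (A : 'M[R]_d) (v : 'cV[R]_d) :
  (v \in E1 A) = (A *m v == v).
Proof.
rewrite memv_ker add_lfunE opp_lfunE scale_lfunE id_lfunE scale1r lfunE.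
by rewrite subr_eq0.
Qed.

(* A pair (j, i) in non_tree_edges is an edge j < i, i.e. i > j. *)
Definition kernel_model (R : realType) (N d : nat) (eta0 eta : digraph N)
    (a : voltage R d eta) : {vspace 'cV[R]_d} :=
  if non_tree_edges eta0 eta == set0 then fullv
  else (\bigcap_(p in non_tree_edges eta0 eta) E1 (a p.2 p.1))%VS.

(* Main.v *)
Require Import Defs.
From HB Require Import structures.
From mathcomp Require Import all_boot all_order all_algebra.
From mathcomp Require Import boolp reals.
From mathcomp Require Import ring.

(** The kernel of the gauged Laplacian is the space of parallel sections, and
    a parallel section over a connected graph is determined by its value at
    one vertex.

    Write <u, v> for the Euclidean product.  Since kappa is symmetric and the
    voltages are orthogonal, summation by parts gives the Dirichlet identity
      2 sum_i Z_i <x_i, (Delta x)_i> = sum_ij kappa_ij |x_i - alpha_ij x_j|^2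
    ([dirichlet_identity]).  All terms on the right are nonnegative, so a
    configuration is harmonic exactly when alpha_ij x_j = x_i along every edge
    ([laplacian_eq0P]).

    A voltage can be gauged away along a tree: the values of the gauge are
    propagated from a root, one new vertex at a time.  Each new vertex is
    joined to the earlier ones by one edge only, as a second edge would close a
    cycle ([unique_neighbour]), so no compatibility condition arises
    ([tree_potential]).  This gives a representation (xi, alpha) of the voltage
    class with alpha = 1 along the tree ([tree_gauge]).

    In that representation a parallel configuration is constant, because the
    tree connects all vertices; and a constant v is parallel exactly when it
    is fixed by the alpha_ij of the remaining edges ([mem_ker_gLap_tree]).
    The isomorphism takes [xi, x] to the common value of x. *)

Set Implicit Arguments.
Unset Strict Implicit.
Unset Printing Implicit Defensive.

Import Order.TTheory GRing.Theory Num.Theory.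
Local Open Scope ring_scope.

(** * Potentials on trees *)

Lemma crossing_edge (T : finType) (e : rel T) (S : {set T}) (x y : T) :
  symmetric e -> connect e x y -> x \in S -> y \notin S ->
  exists i j, [/\ i \in S, j \notin S & e i j].
Proof.
move=> e_sym cxy xS yS; apply: contrapT => nocross.
have clS : closed e S.
  apply: intro_closed; first exact: sym_connect_sym.
  move=> i j eij iS; apply: contrapT => /negP jS.
  by apply: nocross; exists i, j.
by move: yS; rewrite -(closed_connect clS cxy) xS.
Qed.

Definition edge_within (T : finType) (e : rel T) (S : {set T}) : rel T :=
  fun x y => [&& x \in S, y \in S & e x y].

(** Two neighbours of j in S are joined by a simple path inside S; closing that
    path up at j gives a cycle unless the neighbours coincide. *)
Lemma unique_neighbour (T : finType) (e : rel T) (S : {set T}) (i i' j : T) :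
  symmetric e -> (forall c : seq T, (2 < size c)%N -> ~ ucycle e c) ->
  connect (edge_within e S) i i' -> i \in S -> j \notin S ->
  e i j -> e i' j -> i' = i.
Proof.
move=> e_sym acyc /connectP[p0 pth0 e0] iS jS eij ei'j.
case/shortenP: pth0 e0 => p pth upth _ lastp.
case: p pth upth lastp => [|k p] pth upth lastp; first by [].
have pS : all (mem S) (k :: p).
  elim: (k :: p) i pth {upth lastp iS eij} => //= l q IH i.
  by case/andP=> /and3P[_ -> _] /IH.
have pe : path e i (k :: p) by apply: sub_path pth => u v /and3P[].
case: (acyc (j :: i :: k :: p)) => //.
rewrite /ucycle (cons_uniq j) upth andbT inE negb_or; apply/andP; split.
  rewrite /cycle rcons_path /= -[last k p]lastp ei'j andbT e_sym eij.
  exact: pe.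
apply/andP; split; first by apply: contraNneq jS => ->.
by apply: contra jS => /(allP pS).
Qed.

(** The potential is built on larger and larger vertex sets S.  Each S stays
    connected through its own edges, so that [unique_neighbour] applies to the
    next vertex. *)
Lemma tree_potential (T : finType) (e : rel T) (G : groupType)
    (a : T -> T -> G) :
  symmetric e -> irreflexive e ->
  (forall c : seq T, (2 < size c)%N -> ~ ucycle e c) ->
  (forall x y, connect e x y) ->
  (forall i j, e i j -> a i j = (a j i)^-1%g) ->
  exists tau : T -> G, forall i j, e i j -> (tau i * a i j)%g = tau j.
Proof.
move=> e_sym e_irr acyc conn aV.
have grow n : (n < #|T|)%N -> exists S : {set T}, #|S| = n.+1 /\
    (forall x y, x \in S -> y \in S -> connect (edge_within e S) x y) /\
    exists tau : T -> G,
      forall i j, i \in S -> j \in S -> e i j -> (tau i * a i j)%g = tau j.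
  elim: n => [|n IH] ltn.
    have /card_gt0P[r _] := ltn.
    exists [set r]; rewrite cards1; split=> //; split.
      by move=> x y /set1P-> /set1P->.
    by exists (fun=> 1%g) => i j /set1P-> /set1P->; rewrite e_irr.
  have [S [cardS [connS [tau tauP]]]] := IH (ltnW ltn).
  have /card_gt0P[x xS] : (0 < #|S|)%N by rewrite cardS.
  have [y yS] : exists y, y \notin S.
    have : (0 < #|~: S|)%N by rewrite cardsCs setCK subn_gt0 cardS.
    by case/card_gt0P=> y; rewrite inE; exists y.
  have [i [j [iS jS eij]]] := crossing_edge e_sym (conn x y) xS yS.
  have only i' : i' \in S -> e i' j -> i' = i.
    by move=> i'S; apply: unique_neighbour (connS _ _ iS i'S) _ _ eij.
  have subS x0 y0 : connect (edge_within e S) x0 y0 ->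
      connect (edge_within e (j |: S)) x0 y0.
    apply: connect_sub => u v /and3P[uS vS euv]; apply: connect1.
    by rewrite /edge_within !inE uS vS euv !orbT.
  have linkl : edge_within e (j |: S) i j.
    by rewrite /edge_within !inE eqxx iS eij orbT.
  have linkr : edge_within e (j |: S) j i.
    by rewrite /edge_within !inE eqxx iS e_sym eij orbT.
  exists (j |: S); rewrite cardsU1 jS cardS add1n; split=> //; split.
    move=> u v /setU1P[->|uS] /setU1P[->|vS] //.
    - exact: connect_trans (connect1 linkr) (subS _ _ (connS _ _ iS vS)).
    - exact: connect_trans (subS _ _ (connS _ _ uS iS)) (connect1 linkl).
    - exact: subS (connS _ _ uS vS).
  exists (fun u => if u == j then tau i * a i j else tau u)%g => u v.
  have neq w : w \in S -> (w == j) = false.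
    by move=> wS; apply: contraNF jS => /eqP <-.
  move=> /setU1P[->|uS] /setU1P[->|vS]; rewrite ?eqxx ?neq // => euv.
  - by rewrite e_irr in euv.
  - rewrite e_sym in euv; rewrite (only v vS euv) (aV _ _ eij).
    by rewrite mulgVK.
  - by rewrite (only u uS euv).
  - exact: tauP.
have [T0|Tpos] := posnP #|T|.
  by exists (fun=> 1%g) => i; have := fintype0 i T0.
have [|S [cardS [_ [tau tauP]]]] := grow #|T|.-1; first by rewrite prednK.
have ST : S = [set: T].
  by apply/eqP; rewrite eqEcard subsetT cardsT cardS prednK /=.
by exists tau => i j; apply: tauP; rewrite ST inE.
Qed.

(** Acting by a potential tau of alpha turns alpha_ij into
    tau_i alpha_ij tau_j^-1 = 1 along the tree. *)
Lemma tree_gauge (R : realType) (N d : nat) (eta eta0 : digraph N)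
    (w : voltage_class R d eta) :
  spanning_tree eta0 eta ->
  exists (xi : gauge R N d) (a : voltage R d eta),
    w = vclass xi a /\ forall i j, adj eta0 i j -> a i j = 1%g.
Proof.
move=> [sub acyc].
have adj_sub i j : adj eta0 i j -> adj eta i j.
  by rewrite /adj => /orP[/sub->|/sub->]; rewrite ?orbT.
set b := (repr w).2.
have e_irr : irreflexive (adj eta0).
  move=> i; rewrite /adj orbb; apply/negP => eii.
  by move: (edge_asym eii); rewrite eii.
have [tau tauP] := tree_potential (a := b) (adjC eta0) e_irr acyc
  (@edge_connected _ eta0) (fun i j eij => volt_adj b (adj_sub i j eij)).
pose t : gauge R N d := [ffun i => tau i].
exists ((repr w).1 * t^-1)%g, (gauge_voltage t b); split.
  rewrite /vclass class_act /= -gauge_voltageM mulVg gauge_voltage1.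
  by rewrite /class -surjective_pairing reprK.
by move=> i j eij; rewrite gauge_voltageE ?adj_sub // !ffunE tauP // mulgV.
Qed.

(** * The Dirichlet identity *)

Definition dot (R : realType) (d : nat) (u v : 'cV[R]_d) : R :=
  (u^T *m v) 0 0.

Lemma dotC (R : realType) (d : nat) (u v : 'cV[R]_d) : dot u v = dot v u.
Proof. by rewrite /dot -[in LHS](trmxK v) -trmx_mul mxE. Qed.

Lemma dotBr (R : realType) (d : nat) (u v w : 'cV[R]_d) :
  dot u (v - w) = dot u v - dot u w.
Proof. by rewrite /dot mulmxBr !mxE. Qed.

Lemma dotE (R : realType) (d : nat) (u : 'cV[R]_d) :
  dot u u = \sum_i u i 0 ^+ 2.
Proof. by rewrite /dot mxE; apply: eq_bigr => i _; rewrite mxE. Qed.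

Lemma dot_ge0 (R : realType) (d : nat) (u : 'cV[R]_d) : 0 <= dot u u.
Proof. by rewrite dotE sumr_ge0 // => i _; rewrite sqr_ge0. Qed.

Lemma dot_eq0 (R : realType) (d : nat) (u : 'cV[R]_d) :
  dot u u = 0 -> u = 0.
Proof.
rewrite dotE => /psumr_eq0P u0; apply/matrixP => i j; rewrite ord1 mxE.
by apply/eqP; rewrite -sqrf_eq0 u0 // => k _; rewrite sqr_ge0.
Qed.

Lemma dot_SO (R : realType) (d : nat) (A : SO R d) (u v : 'cV[R]_d) :
  dot (A *m u) (A *m v) = dot u v.
Proof.
by rewrite /dot trmx_mul mulmxA -(mulmxA _ _ (SOval A)) SO_mulTmx mulmx1.
Qed.

Lemma kappa_ge0 (R : realType) (N : nat) (eta : digraph N) (k : weight R eta)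
    (i j : 'I_N) : 0 <= k i j.
Proof.
by have [/(kappa_gt0 k)/ltW//|/(kappa_eq0 k)->] := boolP (adj eta i j).
Qed.

(** The case of degree zero is harmless: all the weights at i then vanish. *)
Lemma degree_div (R : realType) (N : nat) (eta : digraph N) (k : weight R eta)
    (i j : 'I_N) : degree k i * (k i j / degree k i) = k i j.
Proof.
have [Z0|Z0] := eqVneq (degree k i) 0; last by rewrite mulrC divfK.
have /psumr_eq0P -> // : \sum_j k i j = 0 by [].
  by rewrite mul0r mulr0.
by move=> l _; apply: kappa_ge0.
Qed.

(** With v = alpha_ij x_j, the identity |u - v|^2 = 2 <u, u - v> + |v|^2 - |u|^2
    reduces the claim to the vanishing of the sum of
    kappa_ij (|x_j|^2 - |x_i|^2), which is antisymmetric in i and j. *)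
Lemma dirichlet_identity (R : realType) (N d : nat) (eta : digraph N)
    (k : weight R eta) (a : voltage R d eta) (x : config R N d) :
  \sum_i \sum_j k i j * dot (x i - a i j *m x j) (x i - a i j *m x j) =
  2 * \sum_i degree k i * dot (x i) (laplacian k a x i).
Proof.
have lapE i : degree k i * dot (x i) (laplacian k a x i) =
    \sum_j k i j * dot (x i) (x i - a i j *m x j).
  rewrite ffunE -sumrN /dot mulmx_sumr summxE mulr_sumr; apply: eq_bigr => j _.
  by rewrite -scalerN opprB -scalemxAr mxE mulrA degree_div.
have flux : \sum_i \sum_j k i j * (dot (x j) (x j) - dot (x i) (x i)) = 0.
  under eq_bigr do under eq_bigr do rewrite mulrBr.
  under eq_bigr do rewrite sumrB.
  rewrite sumrB [X in X - _]exchange_big /=; apply/eqP; rewrite subr_eq0.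
  by apply/eqP; apply: eq_bigr => i _; apply: eq_bigr => j _;
    rewrite kappa_sym.
rewrite -[RHS]addr0 -[X in _ = _ + X]flux mulr_sumr -big_split /=.
apply: eq_bigr => i _; rewrite lapE mulr_sumr -big_split /=.
apply: eq_bigr => j _; rewrite -(dot_SO (a i j) (x j)).
move: (a i j *m x j) (x i) (k i j) => v u c.
by rewrite !dotBr (dotC (u - v) u) (dotC (u - v) v) !dotBr (dotC v u); ring.
Qed.

Lemma laplacian_eq0P (R : realType) (N d : nat) (eta : digraph N)
    (k : weight R eta) (a : voltage R d eta) (x : config R N d) :
  laplacian k a x = 0 <-> forall i j, adj eta i j -> a i j *m x j = x i.
Proof.
split=> [lap0 i j eij|par].
  have energy0 : \sum_i \sum_j
      k i j * dot (x i - a i j *m x j) (x i - a i j *m x j) = 0.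
    rewrite dirichlet_identity lap0 big1 ?mulr0 // => l _.
    by rewrite ffunE /dot mulmx0 mxE mulr0.
  have term_ge0 l m :
      0 <= k l m * dot (x l - a l m *m x m) (x l - a l m *m x m).
    by rewrite mulr_ge0 ?kappa_ge0 ?dot_ge0.
  have /psumr_eq0P/(_ i isT) := energy0.
  move=> /(_ (fun l _ => sumr_ge0 _ (fun m _ => term_ge0 l m))).
  move=> /psumr_eq0P/(_ j isT) => /(_ (fun m _ => term_ge0 i m)) /eqP.
  rewrite mulf_eq0 gt_eqF ?kappa_gt0 //= => /eqP/dot_eq0/eqP.
  by rewrite subr_eq0 => /eqP.
apply/ffunP=> i; rewrite !ffunE big1 ?oppr0 // => j _.
have [/par->|nij] := boolP (adj eta i j); first by rewrite subrr scaler0.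
by rewrite kappa_eq0 // mul0r scale0r.
Qed.

(** * The kernel in a tree gauge *)

Lemma mem_kernel_model (R : realType) (N d : nat) (eta0 eta : digraph N)
    (a : voltage R d eta) (v : 'cV[R]_d) :
  v \in kernel_model eta0 a <->
  forall i j, edge eta i j -> ~~ edge eta0 i j -> a j i *m v = v.
Proof.
rewrite /kernel_model; case: eqP => [E0|_]; split=> [vE i j eij nij|fix_v].
- have : (i, j) \in non_tree_edges eta0 eta by rewrite inE /= eij.
  by rewrite E0 inE.
- exact: memvf.
- have pE : (i, j) \in non_tree_edges eta0 eta by rewrite inE /= eij.
  move: vE; rewrite memvE => /subv_bigcapP/(_ _ pE).
  by rewrite -memvE mem_E1 => /eqP.
rewrite memvE; apply/subv_bigcapP => -[i j]; rewrite inE /= => /andP[eij nij].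
by rewrite -memvE mem_E1 fix_v.
Qed.

(** An edge is listed in one direction only; the inverse of alpha_ij fixes the
    same vectors. *)
Lemma kernel_model_parallel (R : realType) (N d : nat) (eta0 eta : digraph N)
    (a : voltage R d eta) (v : 'cV[R]_d) :
  (forall i j, adj eta0 i j -> a i j = 1%g) ->
  v \in kernel_model eta0 a <-> forall i j, adj eta i j -> a i j *m v = v.
Proof.
move=> a1; rewrite mem_kernel_model; split=> [fix_v|par i j eij _]; last first.
  by apply: par; rewrite /adj eij orbT.
have fix_edge i j : edge eta i j -> a j i *m v = v.
  move=> eij; have [e0ij|] := boolP (edge eta0 i j); last exact: fix_v.
  by rewrite a1 /= ?mul1mx // /adj e0ij orbT.
move=> i j eij; case/orP: (eij) => [eij'|]; last exact: fix_edge.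
by rewrite (volt_adj a eij) -{1}(fix_edge i j eij') mulmxA /= SO_mulTmx mul1mx.
Qed.

Lemma parallel_const (R : realType) (N d : nat) (eta0 eta : digraph N)
    (a : voltage R d eta) (x : config R N d) :
  subrel (adj eta0) (adj eta) ->
  (forall i j, adj eta0 i j -> a i j = 1%g) ->
  (forall i j, adj eta i j -> a i j *m x j = x i) -> forall i j, x i = x j.
Proof.
move=> sub a1 par i j.
have /connectP[p + ->] := edge_connected eta0 i j.
elim: p i => //= l p IH i /andP[eil /IH <-].
by rewrite -(par i l) ?a1 /= ?mul1mx //; apply: sub.
Qed.

(** Harmonic configurations are parallel, hence constant since the voltage is
    trivial along the connected tree; what is left of parallelism is that the
    constant is fixed by every edge. *)
Lemma mem_ker_gLap_tree (R : realType) (N d : nat) (eta0 eta : digraph N)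
    (k : weight R eta) (xi : gauge R N d) (a : voltage R d eta)
    (x : config R N d) (i0 : 'I_N) :
  subrel (adj eta0) (adj eta) ->
  (forall i j, adj eta0 i j -> a i j = 1%g) ->
  sect xi x \in ker_gLap k (vclass xi a) <->
  x i0 \in kernel_model eta0 a /\ x = [ffun=> x i0].
Proof.
move=> sub a1; rewrite mem_ker_gLap gLapE kernel_model_parallel //.
have -> : sect xi (laplacian k a x) == 0 <-> laplacian k a x = 0.
  split=> [/eqP lap0|->]; last by rewrite linear0.
  by apply: (can_inj (sectK xi)); rewrite lap0 linear0.
rewrite laplacian_eq0P; split=> [par|[fixed xE] i j eij].
  have cst i : x i = x i0 by exact: parallel_const sub a1 par i i0.
  split; last by apply/ffunP=> i; rewrite ffunE.
  by move=> i j eij; have := par i j eij; rewrite !cst.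
by rewrite xE !ffunE fixed.
Qed.

Theorem theorem4p14 (R : realType) (N d : nat) (hN : (1 < N)%N) (hd : (0 < d)%N)
    (eta : digraph N) (k : weight R eta) (eta0 : digraph N)
    (hT : spanning_tree eta0 eta) (w : voltage_class R d eta) :
  exists (xi : gauge R N d) (a : voltage R d eta),
    w = vclass xi a /\
    exists f : {linear subvs_of (ker_gLap k w) ->
                       subvs_of (kernel_model eta0 a)},
      bijective f /\
      (forall (g : subvs_of (ker_gLap k w)) (x : config R N d),
         vsval g = sect xi x -> forall i : 'I_N, vsval (f g) = x i).
Proof.
have [xi [a [wE a1]]] := tree_gauge w hT.
have sub : subrel (adj eta0) (adj eta).
  by move=> i j; rewrite /adj => /orP[] /hT.1 ->; rewrite ?orbT.
exists xi, a; split=> //; subst w.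
pose i0 : 'I_N := Ordinal (ltnW hN).
have kerP x := mem_ker_gLap_tree k xi x i0 sub a1.
set K := ker_gLap k _ in kerP *; set M := kernel_model _ _ in kerP *.
pose f (g : subvs_of K) : subvs_of M := vsproj M (sect_coord xi (vsval g) i0).
pose h (v : subvs_of M) : subvs_of K := vsproj K (sect xi [ffun=> vsval v]).
have f_lin : linear f.
  by move=> r g g'; rewrite /f !linearP /= !ffunE linearP.
have coordP (g : subvs_of K) : sect_coord xi (vsval g) i0 \in M /\
    sect_coord xi (vsval g) = [ffun=> sect_coord xi (vsval g) i0].
  by apply/kerP; rewrite sect_coordK subvsP.
have fE g : vsval (f g) = sect_coord xi (vsval g) i0.
  by rewrite vsprojK //; have [] := coordP g.
have hE v : vsval (h v) = sect xi [ffun=> vsval v].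
  by rewrite vsprojK //; apply/kerP; rewrite ffunE; split=> //; apply: subvsP.
pose f_linear := GRing.isLinear.Build R (subvs_of K) (subvs_of M) *:%R f f_lin.
pose F : {linear subvs_of K -> subvs_of M} := HB.pack f f_linear.
exists F; split.
  exists h => [g|v] /=; apply: val_inj => /=.
    by rewrite hE fE -(coordP g).2 sect_coordK.
  by rewrite fE hE sectK ffunE.
move=> g x gE i /=; rewrite fE.
by have [_] := coordP g; rewrite gE sectK => /ffunP/(_ i); rewrite ffunE.
Qed.
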